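(* Let $p$ be an odd prime and let $K$, $L$, $M$, $N$ be integers with $0\le K<K+M<p$ and $0\le L<L+N<p$. For an integer $r\ge 0$ and an integer $\lambda$, let $Q_r(K,M;L,N;\lambda)$ be the number of tuples of integers $(m,n,n_1,\ldots,n_r)$ with $K+1\le m\le K+M$ and $L+1\le n,n_1,\ldots,n_r\le L+N$ satisfying $$m!\,n!+\sum_{i=1}^{r} n_i!\equiv\lambda\pmod p.$$ Put $r_1=\lfloor r/2\rfloor$ and $r_2=\lfloor (r+1)/2\rfloor$. Then for any integers $k,\ell\ge 1$, $$\left|Q_r(K,M;L,N;\lambda)-\frac{MN^{r+1}}{p}\right|\ll M^{1-\frac{1}{2\ell(k+1)}}\;N^{\,r+\frac{1}{2(r_1+1)}+\frac{1}{2(r_2+1)}-\frac{1}{2k(\ell+1)}}\;p^{\frac{1}{2k\ell}}.$$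
   Context: The notation $U\ll V$ means $|U|\le cV$ for some constant $c>0$; here $c$ may depend on $k,\ell,r$ only (not on $p$, $K$, $L$, $M$, $N$, $\lambda$). *)

(* Defs.v *)
From HB Require Import structures.
From mathcomp Require Import all_boot all_order all_algebra.

Set Implicit Arguments.
Unset Strict Implicit.
Unset Printing Implicit Defensive.

Import Order.TTheory GRing.Theory Num.Theory.

(* The bounds m <= K + M and n, n_i <= L + N are carried by the ordinal types
   (whose nat values start at 0); only the lower bounds appear explicitly. *)
Definition Q (p r K M L N : nat) (lambda : int) : nat :=
  #|[set t : 'I_(K + M).+1 * 'I_(L + N).+1 * {ffun 'I_r -> 'I_(L + N).+1} |
     let: (m, n, s) := t in
     [&& (K < m)%N, (L < n)%N, [forall i, (L < s i)%N]
       & ((m`! * n`! + \sum_(i < r) (s i)`!)%N%:Z == lambda %[mod p])%Z]]|.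

(* Main.v *)
(** The exponential sums
      [S(a) = sum_n e(a n!)] and [W(a) = sum_(m, n) e(a m! n!)]
    express [p Q - M N^(r+1)] as [sum_(a != 0) W(a) S(a)^r e(- a lambda)].
    Cauchy-Schwarz bounds [sum_a |S(a)|^r] by [p sqrt (J_r1 J_r2)], where the
    additive energy [J_l] counts the solutions of
    [n_1! + .. + n_l! = n_(l+1)! + .. + n_(2l)!] modulo [p], and two applications of
    Hoelder's inequality bound [W(a)^(2kl)] by
    [M^(2k(l-1)) N^(2l(k-1)) J_k(M) p J_l(N)].

    To bound [J_l(N)] by [N^(2l-1+1/(l+1))], cut the range into blocks of length
    [H ~ N^(1/(l+1))]; by Hoelder it suffices to count the solutions with all the
    variables in one block.  Write them as [m + h_i] with [m] the smallest one, so that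
    [(m + h_i)! = m! (m + 1) .. (m + h_i)].  Either every value of [h] is taken at
    least twice, which leaves few choices for [h], or the signed sum of the rising
    factorials is a nonzero polynomial of degree less than [H] that vanishes at [m]. *)

Require Import Defs.
From mathcomp Require Import all_boot all_order all_algebra all_field.
From mathcomp Require Import all_classical all_reals all_analysis.
From mathcomp Require Import ring lra zify.

Set Implicit Arguments.
Unset Strict Implicit.
Unset Printing Implicit Defensive.

Import Order.TTheory GRing.Theory Num.Theory.

Local Open Scope ring_scope.

(** * Power means *)

Section SumInequalities.
Variables (R : numDomainType) (I : finType) (P : pred I).
Implicit Types w x y : I -> R.

(** Twice a double sum over the same index set is the sum of its symmetrised terms, so it suffices
    to compare those. Both inequalities below become the sign of one symmetric expression in [i] and
    [j]. *)
Lemma ler_sum_prod_sym (F G : I -> I -> R) :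
  (forall i j, P i -> P j -> F i j + F j i <= G i j + G j i) ->
  \sum_(i | P i) \sum_(j | P j) F i j <= \sum_(i | P i) \sum_(j | P j) G i j.
Proof.
move=> FG.
have sym (K : I -> I -> R) : (\sum_(i | P i) \sum_(j | P j) K i j) *+ 2 =
    \sum_(i | P i) \sum_(j | P j) (K i j + K j i).
  rewrite mulr2n [X in _ + X]exchange_big -big_split /=.
  by apply: eq_bigr => i _; rewrite -big_split.
rewrite -(ler_pMn2r (ltn0Sn 1)) !sym.
by apply: ler_sum => i Pi; apply: ler_sum => j Pj; apply: FG.
Qed.

(** Lagrange's identity: the symmetrised difference is a square. *)
Lemma cauchy_schwarz_sum x y :
  (forall i, P i -> 0 <= x i) -> (forall i, P i -> 0 <= y i) ->
  (\sum_(i | P i) x i * y i) ^+ 2 <=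
    (\sum_(i | P i) x i ^+ 2) * (\sum_(i | P i) y i ^+ 2).
Proof.
move=> x0 y0; rewrite expr2 !big_distrlr /=; apply: ler_sum_prod_sym => i j Pi Pj.
rewrite -subr_ge0.
have -> : x i ^+ 2 * y j ^+ 2 + x j ^+ 2 * y i ^+ 2
   - (x i * y i * (x j * y j) + x j * y j * (x i * y i))
   = (x i * y j - x j * y i) ^+ 2 by ring.
by rewrite real_exprn_even_ge0 // rpredB // ger0_real // mulr_ge0 ?x0 ?y0.
Qed.

(** Induction on [k]; the step is Chebyshev's sum inequality for the similarly ordered families [x]
    and [x ^+ k.+1]. *)
Lemma power_mean w x k :
  (forall i, P i -> 0 <= w i) -> (forall i, P i -> 0 <= x i) ->
  (\sum_(i | P i) w i * x i) ^+ k.+1 <=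
    (\sum_(i | P i) w i) ^+ k * \sum_(i | P i) w i * x i ^+ k.+1.
Proof.
move=> w0 x0; elim: k => [|k IHk]; first by rewrite expr0 mul1r expr1.
have wx0 : 0 <= \sum_(i | P i) w i * x i.
  by apply: sumr_ge0 => i Pi; rewrite mulr_ge0 ?w0 ?x0.
rewrite exprS; apply: le_trans (ler_wpM2l wx0 IHk) _.
rewrite mulrCA [X in _ <= X * _]exprSr -mulrA ler_wpM2l //.
  by rewrite exprn_ge0 // sumr_ge0.
rewrite !big_distrlr /=; apply: ler_sum_prod_sym => i j Pi Pj.
rewrite -subr_ge0.
have -> : w i * (w j * x j ^+ k.+2) + w j * (w i * x i ^+ k.+2) -
   (w i * x i * (w j * x j ^+ k.+1) + w j * x j * (w i * x i ^+ k.+1)) =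
   (w i * w j) * ((x i - x j) * (x i ^+ k.+1 - x j ^+ k.+1)).
  by rewrite !(exprS _ k.+1); ring.
apply: mulr_ge0; first by rewrite mulr_ge0 ?w0.
have mono a b : 0 <= a -> a <= b -> 0 <= (b - a) * (b ^+ k.+1 - a ^+ k.+1).
  move=> a0 ab; rewrite mulr_ge0 ?subr_ge0 // lerXn2r ?qualifE //=.
  exact: le_trans ab.
have /orP[xij|xji] := real_leVge (ger0_real (x0 i Pi)) (ger0_real (x0 j Pj)).
  by rewrite -mulrNN !opprB mono ?x0.
by rewrite mono ?x0.
Qed.

End SumInequalities.

Lemma power_mean_card (R : numDomainType) (I : finType) (A : {pred I}) (x : I -> R) k :
  (forall i, i \in A -> 0 <= x i) ->
  (\sum_(i in A) x i) ^+ k.+1 <= #|A|%:R ^+ k * \sum_(i in A) x i ^+ k.+1.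
Proof.
move=> x0; have := @power_mean R I [in A] (fun=> 1) x k (fun _ _ => ler01) x0.
rewrite sumr_const; congr (_ ^+ _ <= _ * _).
  by apply: eq_bigr => i _; rewrite mul1r.
by apply: eq_bigr => i _; rewrite mul1r.
Qed.

(** * Additive characters and energies *)

Section ExponentialSums.
Variables (F : finFieldType) (e : F -> algC).
Hypothesis eD : forall x y, e (x + y) = e x * e y.
Hypothesis e_norm : forall x, `|e x| = 1.
Hypothesis e_nontrivial : exists u, e u != 1.
Local Notation q := (#|F|).

Let e_neq0 x : e x != 0.
Proof. by rewrite -normr_eq0 e_norm oner_eq0. Qed.

Let e0 : e 0 = 1.
Proof. by apply: (mulfI (e_neq0 0)); rewrite -eD addr0 mulr1. Qed.

Let eN x : e (- x) = (e x)^*.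
Proof.
have -> : (e x)^* = (e x)^-1 by rewrite invC_norm e_norm expr1n invr1 mul1r.
by apply: (mulfI (e_neq0 x)); rewrite -eD subrr e0 divff.
Qed.

Let e_sum (I : finType) (P : pred I) (g : I -> F) :
  e (\sum_(i | P i) g i) = \prod_(i | P i) e (g i).
Proof. exact: (big_morph e eD e0). Qed.

(** For [x != 0] the translation of [a] by [u / x] multiplies the sum by [e u != 1], so the sum
    vanishes. *)
Lemma char_sum x : \sum_a e (a * x) = if x == 0 then q%:R else 0.
Proof.
case: eqP => [->|/eqP x0].
  under eq_bigr do rewrite mulr0 e0.
  by rewrite sumr_const.
have [u eu] := e_nontrivial.
apply/eqP; have: (e u - 1) * (\sum_a e (a * x)) == 0.
  rewrite mulrBl mul1r subr_eq0 mulr_sumr; apply/eqP.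
  rewrite [RHS](reindex_inj (addIr (u / x))) /=.
  by apply: eq_bigr => a _; rewrite mulrDl divfK // eD mulrC.
by rewrite mulf_eq0 subr_eq0 (negPf eu).
Qed.

(** Expand the product into choice functions [z]; orthogonality in [a] then detects the linear
    equation. The weights [th] may depend on the factor, which leaves room for conjugates. *)
Lemma sum_prod_expsum (T I : finType) (A : {set I}) (f : I -> F) (s : T -> F)
    (th : T -> I -> algC) :
  \sum_a \prod_t (\sum_(i in A) th t i * e (a * (s t * f i))) =
  \sum_(z : {ffun T -> I} | z \in ffun_on [in A])
     (\prod_t th t (z t)) * (if \sum_t s t * f (z t) == 0 then q%:R else 0).
Proof.
under eq_bigr do rewrite bigA_distr_big.
rewrite exchange_big /=; apply: eq_bigr => z _.
rewrite -char_sum mulr_sumr; apply: eq_bigr => a _.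
by rewrite big_split mulr_sumr e_sum.
Qed.

Lemma parseval (c : F -> algC) :
  \sum_a `|\sum_u c u * e (a * u)| ^+ 2 = q%:R * \sum_u `|c u| ^+ 2.
Proof.
transitivity (\sum_a \sum_u \sum_v c u * (c v)^* * e (a * (u - v))).
  apply: eq_bigr => a _; rewrite normCK rmorph_sum big_distrlr /=.
  apply: eq_bigr => u _; apply: eq_bigr => v _.
  by rewrite rmorphM /= -eN mulrACA -eD mulrBr.
rewrite exchange_big mulr_sumr; apply: eq_bigr => u _ /=.
rewrite exchange_big /= (bigD1 u) //= [X in _ + X]big1 => [|v vu];
  rewrite -mulr_sumr char_sum.
  by rewrite subrr eqxx addr0 normCK mulrC.
by rewrite subr_eq0 eq_sym (negPf vu) mulr0.
Qed.

Section Moments.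
Variables (I : finType) (f : I -> F).
Implicit Types (A : {set I}) (th : I -> algC).

Definition expsum A th a := \sum_(i in A) th i * e (a * f i).

(** The sum type separates the two sides of the energy equation, which thus becomes a single signed
    sum. *)
Definition plusminus l (t : 'I_l + 'I_l) : F := if t is inl _ then 1 else -1.

Definition energy l A := #|[set z : {ffun 'I_l + 'I_l -> I} | z \in ffun_on [in A] &
    \sum_t plusminus t * f (z t) == 0]|.

Definition rep_num k A u := #|[set x : {ffun 'I_k -> I} | x \in ffun_on [in A] &
    \sum_i f (x i) == u]|.

(** Write the even power of the modulus as [l] copies of the sum times [l] copies of its conjugate;
    conjugation turns [e (a * f i)] into [e (a * (-1 * f i))]. *)
Let momentE l A th : \sum_a `|expsum A th a| ^+ (2 * l) =
  \sum_(z : {ffun 'I_l + 'I_l -> I} | z \in ffun_on [in A])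
     (\prod_t (if t is inl _ then th (z t) else (th (z t))^*)) *
     (if \sum_t plusminus t * f (z t) == 0 then q%:R else 0).
Proof.
rewrite -(sum_prod_expsum A f (@plusminus l)
  (fun t i => if t is inl _ then th i else (th i)^*)).
apply: eq_bigr => a _; rewrite big_sumType /= !prodr_const !card_ord.
rewrite exprM normCK exprMn rmorph_sum; congr (_ ^+ l * _ ^+ l).
  by apply: eq_bigr => i _; rewrite mul1r.
by apply: eq_bigr => i _; rewrite rmorphM /= -eN mulN1r mulrN.
Qed.

Lemma moment1 l A :
  \sum_a `|expsum A (fun=> 1) a| ^+ (2 * l) = q%:R * (energy l A)%:R.
Proof.
rewrite momentE mulr_natr -[RHS]sumr_const.
rewrite [RHS](eq_bigl (fun z : {ffun 'I_l + 'I_l -> I} => (z \in ffun_on [in A]) &&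
   (\sum_t plusminus t * f (z t) == 0))) => [|z]; last by rewrite inE.
rewrite [RHS]big_mkcondr; apply: eq_bigr => z _; rewrite big1 ?mul1r // => -[] //= _ _.
by rewrite rmorph1.
Qed.

(** In the expansion [momentE] the weights multiply nonnegative terms by factors of modulus at most
    1, so the moment is largest for trivial weights. *)
Lemma moment_le l A th : (forall i, i \in A -> `|th i| <= 1) ->
  \sum_a `|expsum A th a| ^+ (2 * l) <= q%:R * (energy l A)%:R.
Proof.
move=> th1; rewrite -moment1 !momentE.
apply: le_trans (real_ler_norm _) _.
  by rewrite -momentE ger0_real // sumr_ge0 // => a _; rewrite exprn_ge0.
apply: le_trans (ler_norm_sum _ _ _) _; apply: ler_sum => z /ffun_onP zA.
rewrite [X in _ <= X * _]big1 => [|[] //= _ _]; last by rewrite rmorph1.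
rewrite mul1r normrM normr_prod.
have -> : `|if \sum_t plusminus t * f (z t) == 0 then q%:R else 0| =
   (if \sum_t plusminus t * f (z t) == 0 then q%:R else 0 : algC).
  by case: ifP; rewrite ?normr0 ?normr_nat.
rewrite ler_piMl //; first by case: ifP.
by rewrite prodr_ile1 // => -[] j _; rewrite ?norm_conjC normr_ge0 th1 // zA.
Qed.

Lemma expsum_exp k A a : expsum A (fun=> 1) a ^+ k =
  \sum_(x : {ffun 'I_k -> I} | x \in ffun_on [in A]) e (a * \sum_i f (x i)).
Proof.
have -> : expsum A (fun=> 1) a ^+ k =
    \prod_(j < k) \sum_(i in A) (e (a * f i)).
  rewrite prodr_const card_ord; congr (_ ^+ _).
  by apply: eq_bigr => i _; rewrite mul1r.
rewrite bigA_distr_big; apply: eq_bigr => x _.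
by rewrite -e_sum mulr_sumr.
Qed.

Lemma expsum_exp_rep_num k A a :
  expsum A (fun=> 1) a ^+ k = \sum_u (rep_num k A u)%:R * e (a * u).
Proof.
rewrite expsum_exp (partition_big (fun x : {ffun 'I_k -> I} => \sum_i f (x i)) predT) //=.
apply: eq_bigr => u _; rewrite mulr_natl -sumr_const.
by apply: eq_big => [x|x /andP[_ /eqP <-]]; rewrite ?inE.
Qed.

(** The Fourier coefficients of the [k]-th power of the exponential sum are the representation
    numbers; Parseval computes its [2 * k]-th moment a second time. *)
Lemma sum_rep_num_sqr k A : (\sum_u rep_num k A u ^ 2)%N = energy k A.
Proof.
have q0 : q%:R != 0 :> algC by rewrite pnatr_eq0 -lt0n; apply/card_gt0P; exists 0.
apply/eqP; rewrite -(eqr_nat algC); apply/eqP; apply: (mulfI q0).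
rewrite -moment1 natr_sum.
under [RHS]eq_bigr do rewrite mulnC exprM -normrX expsum_exp_rep_num.
by rewrite parseval; congr (_ * _); apply: eq_bigr => u _; rewrite normr_nat natrX.
Qed.

Lemma sum_rep_num k A : (\sum_u rep_num k A u)%N = (#|A| ^ k)%N.
Proof.
rewrite -[in RHS](card_ord k) -(card_ffun_on _ [in A]) -sum1_card.
rewrite (partition_big (fun x : {ffun 'I_k -> I} => \sum_i f (x i)) predT) //=.
by apply: eq_bigr => u _; rewrite /rep_num -sum1_card; apply: eq_bigl => x; rewrite inE.
Qed.

End Moments.
End ExponentialSums.

(** * Bilinear exponential sums and Hoelder's inequality *)

Section BilinearSums.
Variables (F : finFieldType) (e : F -> algC).
Hypothesis eD : forall x y, e (x + y) = e x * e y.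
Hypothesis e_norm : forall x, `|e x| = 1.
Hypothesis e_nontrivial : exists u, e u != 1.
Variables (I J : finType) (f : I -> F) (g : J -> F) (A : {set I}) (B : {set J}).
Local Notation q := (#|F|).

Definition bilinear_sum a := \sum_(i in A) \sum_(j in B) e (a * (f i * g j)).

Definition bilinear_bound k l : nat :=
  ((#|A| ^ k.+1) ^ l) ^ 2 * (#|B| ^ k) ^ (2 * l.+1) *
  (energy f k.+1 A * (q * energy g l.+1 B)).

Lemma bilinear_sum_le k l a : a != 0 ->
  `|bilinear_sum a| ^+ (2 * (k.+1 * l.+1)) <= (bilinear_bound k l)%:R.
Proof.
move=> a0.
pose S j := expsum e f A (fun=> 1) (a * g j).
(* This phase turns [S j ^+ k.+1] into its modulus. If [S j = 0], division by zero makes it 0, which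
   still has modulus at most 1. *)
pose th j := (`|S j| / S j) ^+ k.+1.
have th1 j : j \in B -> `|th j| <= 1.
  move=> _; rewrite normrX normrM normfV normr_id exprn_ile1 ?divr_ge0 //.
  by case: (eqVneq (S j) 0) => [->|Sj]; rewrite ?normr0 ?mul0r // divff ?normr_eq0.
(* First Hoelder step, over [j]: expanding [S j ^+ k.+1] in the representation numbers [w u] and
   exchanging the sums leaves the weighted sums [T u]. *)
pose T u := expsum e g B th (a * u).
pose w u : algC := (rep_num f k.+1 A u)%:R.
have le1 : `|bilinear_sum a| ^+ k.+1 <= #|B|%:R ^+ k * \sum_u w u * `|T u|.
  have -> : bilinear_sum a = \sum_(j in B) S j.
    rewrite /bilinear_sum exchange_big; apply: eq_bigr => j _.
    by apply: eq_bigr => i _; rewrite mul1r mulrAC mulrA.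
  have le_norm := ler_norm_sum (index_enum J) S (mem B).
  apply: le_trans (lerXn2r k.+1 _ _ le_norm) _; rewrite ?qualifE /= ?sumr_ge0 //.
  apply: le_trans (power_mean_card _ _) _ => //.
  apply: ler_wpM2l; first by rewrite exprn_ge0.
  (* A nonnegative sum equals its own modulus, so the triangle inequality can be applied after the
     exchange of sums. *)
  rewrite -[X in X <= _]ger0_norm; last by apply: sumr_ge0 => j _; rewrite exprn_ge0.
  have -> : \sum_(j in B) `|S j| ^+ k.+1 = \sum_u w u * T u.
    transitivity (\sum_(j in B) \sum_u w u * (th j * e (a * u * g j))).
      apply: eq_bigr => j _.
      transitivity (th j * S j ^+ k.+1).
        rewrite /th -exprMn; case: (eqVneq (S j) 0) => [->|Sj].
          by rewrite normr0 !mulr0.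
        by rewrite divfK.
      rewrite expsum_exp_rep_num // mulr_sumr; apply: eq_bigr => u _.
      by rewrite mulrCA mulrAC.
    by rewrite exchange_big; apply: eq_bigr => u _; rewrite mulr_sumr.
  apply: le_trans (ler_norm_sum _ _ _) _; apply: ler_sum => u _.
  by rewrite normrM normr_nat.
(* Second Hoelder step, over [u] with weights [w], of total mass [#|A| ^ k.+1]. Cauchy-Schwarz then
   separates [w], whose square sum is an energy, from a moment of [T]. *)
have le2 : (\sum_u w u * `|T u|) ^+ (2 * l.+1) <=
    ((#|A| ^ k.+1) ^ l)%:R ^+ 2 * ((energy f k.+1 A)%:R * (q * energy g l.+1 B)%:R).
  rewrite mulnC exprM.
  have w0 u : 0 <= w u by rewrite ler0n.
  have := @power_mean algC F predT w (fun u => `|T u|) l.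
  rewrite -natr_sum sum_rep_num -natrX => pm.
  have sq a' b' : 0 <= a' -> a' <= b' -> a' ^+ 2 <= b' ^+ 2 :> algC.
    by move=> a'0 ab; rewrite lerXn2r ?qualifE //= (le_trans a'0).
  apply: le_trans (sq _ _ _ (pm _ _)) _ => //.
    by rewrite exprn_ge0 // sumr_ge0 // => u _; rewrite mulr_ge0.
  rewrite exprMn ler_wpM2l ?exprn_ge0 //.
  have := @cauchy_schwarz_sum algC F predT w (fun u => `|T u| ^+ l.+1).
  move=> cs; apply: le_trans (cs _ _) _ => //.
  have -> : \sum_u w u ^+ 2 = (energy f k.+1 A)%:R.
    rewrite -(sum_rep_num_sqr eD e_norm) // natr_sum.
    by apply: eq_bigr => u _; rewrite natrX.
  rewrite ler_wpM2l // natrM.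
  apply: le_trans (moment_le eD e_norm e_nontrivial g l.+1 th1).
  (* As [a != 0], [a * u] runs over the whole field, so this is a complete moment. *)
  rewrite [X in _ <= X](reindex_inj (mulfI a0)) /=.
  by apply: ler_sum => u _; rewrite -exprM mulnC.
rewrite mulnCA exprM.
have -> : (bilinear_bound k l)%:R = (#|B|%:R ^+ k) ^+ (2 * l.+1) *
   (((#|A| ^ k.+1) ^ l)%:R ^+ 2 * ((energy f k.+1 A)%:R *
      (q * energy g l.+1 B)%:R)) :> algC.
  by rewrite /bilinear_bound -!natrX -!natrM; congr (_ %:R); lia.
apply: le_trans (lerXn2r (2 * l.+1) _ _ le1) _; rewrite ?qualifE /= ?exprn_ge0 //.
  by rewrite mulr_ge0 ?exprn_ge0 ?sumr_ge0 // => u _; rewrite mulr_ge0 ?ler0n.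
by rewrite exprMn ler_wpM2l // !exprn_ge0.
Qed.

(** * Counting solutions by exponential sums *)

Section Counting.
Variables (r1 r2 : nat) (c : F).
Local Notation r := (r1 + r2)%N.

Definition solutions := [set t : I * J * {ffun 'I_r -> J} |
  [&& t.1.1 \in A, t.1.2 \in B, t.2 \in ffun_on [in B]
    & f t.1.1 * g t.1.2 + \sum_i g (t.2 i) == c]].

Lemma card_solutions : (q * #|solutions|)%:R =
  \sum_a bilinear_sum a * expsum e g B (fun=> 1) a ^+ r * e (a * - c).
Proof.
pose X (t : I * J * {ffun 'I_r -> J}) := f t.1.1 * g t.1.2 + \sum_i g (t.2 i) - c.
pose P (t : I * J * {ffun 'I_r -> J}) :=
  ((t.1.1 \in A) && (t.1.2 \in B)) && (t.2 \in ffun_on [in B]).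
have -> : (q * #|solutions|)%:R = \sum_(t | P t) \sum_a e (a * X t).
  rewrite mulnC natrM mulr_natl -sumr_const.
  rewrite [LHS](eq_bigl (fun t => P t && (X t == 0))) => [|t].
    rewrite big_mkcondr; apply: eq_bigr => t _.
    by rewrite (char_sum eD).
  by rewrite inE /P /X subr_eq0 -!andbA.
rewrite exchange_big; apply: eq_bigr => a _ /=.
rewrite (expsum_exp eD e_norm) //.
transitivity ((\sum_(i in A) \sum_(j in B) e (a * (f i * g j))) *
   (\sum_(x : {ffun 'I_r -> J} | x \in ffun_on [in B]) e (a * \sum_i g (x i)))
   * e (a * - c)).
  rewrite (pair_big [in A] [in B]) /= big_distrlr /= mulr_suml.
  under [RHS]eq_bigr do rewrite mulr_suml.
  rewrite (pair_big (fun p : I * J => (p.1 \in A) && (p.2 \in B)) (ffun_on [in B]))/=.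
  by apply: eq_bigr => t _; rewrite /X !mulrDr !eD.
by [].
Qed.

(** The exponent [n] is the one in [bilinear_sum_le], and the further factor 2 serves Cauchy-Schwarz
    on the sum of [y]; the bound is thus free of roots. *)
Lemma card_solutions_deviation k l (n := (2 * (k.+1 * l.+1))%N) :
  `|(q * #|solutions|)%:Z - (#|A| * #|B| ^ r.+1)%:Z| ^+ (n * 2) <=
  (((q * energy g r1 B) * (q * energy g r2 B)) ^ n * bilinear_bound k l ^ 2)%N%:Z.
Proof.
rewrite -(ler_int algC) rmorphXn /= intr_norm rmorphB /= -!pmulrn.
set D : algC := _ - _; set y := fun a => `|expsum e g B (fun=> 1) a| ^+ r.
have y0 a : 0 <= y a by rewrite exprn_ge0.
have leD : `|D| <= \sum_(a | a != 0) y a * `|bilinear_sum a|.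
  (* The frequency [a = 0] contributes exactly the expected main term. *)
  have -> : D = \sum_(a | a != 0)
     bilinear_sum a * expsum e g B (fun=> 1) a ^+ r * e (a * - c).
    rewrite /D card_solutions (bigD1 0) //= addrAC.
    have ez x : e (0 * x) = 1.
      rewrite mul0r; have := e_norm 0; have := eD 0 0; rewrite addr0 => e00 n0.
      have /mulfI : e 0 != 0 by rewrite -normr_eq0 n0 oner_eq0.
      by apply; rewrite -e00 mulr1.
    have -> : bilinear_sum 0 = (#|A| * #|B|)%:R.
      rewrite /bilinear_sum natrM mulr_natl -sumr_const; apply: eq_bigr => i _.
      by rewrite -sumr_const; apply: eq_bigr => j _; rewrite ez.
    have -> : expsum e g B (fun=> 1) 0 = #|B|%:R.
      by rewrite -sumr_const; apply: eq_bigr => j _; rewrite ez mulr1.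
    by rewrite ez mulr1 -natrX -natrM -mulnA -expnS subrr add0r.
  apply: le_trans (ler_norm_sum _ _ _) _; apply: ler_sum => a _.
  by rewrite !normrM normrX e_norm mulr1 mulrC.
have leY : \sum_(a | a != 0) y a <= \sum_a y a.
  by rewrite [X in _ <= X](bigID (fun a => a != 0)) /= lerDl sumr_ge0.
have Y0 : 0 <= \sum_(a | a != 0) y a by rewrite sumr_ge0.
(* Split the [r]-th power into exponents [r1] and [r2]; Cauchy-Schwarz gives two even moments. *)
have leY2 : (\sum_a y a) ^+ 2 <= ((q * energy g r1 B) * (q * energy g r2 B))%:R.
  under eq_bigr do rewrite /y exprD.
  apply: le_trans (cauchy_schwarz_sum _ _) _ => [a _|a _|]; rewrite ?exprn_ge0 //.
  rewrite natrM !(natrM _ q) -!(moment1 eD e_norm e_nontrivial).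
  by under eq_bigr do rewrite -exprM mulnC;
     under [X in _ * X <= _]eq_bigr do rewrite -exprM mulnC.
have leDn : `|D| ^+ n <= (\sum_a y a) ^+ n * (bilinear_bound k l)%:R.
  apply: le_trans (lerXn2r n _ _ leD) _; rewrite ?qualifE /= ?sumr_ge0 //.
    by move=> a _; rewrite mulr_ge0.
  have -> : n = n.-1.+1 by [].
  (* Power mean with weights [y a]: the [n]-th power moves onto the bilinear sums, each of which has
     the same bound. *)
  apply: le_trans (power_mean _ _ _) _ => //.
  rewrite [X in _ <= X * _]exprSr -mulrA.
  apply: ler_pM; rewrite ?exprn_ge0 ?sumr_ge0 //.
  - by move=> a _; rewrite mulr_ge0 ?exprn_ge0.
  - by rewrite lerXn2r ?qualifE /= ?sumr_ge0.
  - apply: le_trans (ler_wpM2r (ler0n _ _) leY).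
    rewrite mulr_suml; apply: ler_sum => a a0.
    by rewrite ler_wpM2l // bilinear_sum_le.
rewrite exprM; apply: le_trans (lerXn2r 2 _ _ leDn) _; rewrite ?qualifE /= ?exprn_ge0 //.
  by rewrite mulr_ge0 ?exprn_ge0 ?sumr_ge0.
rewrite exprMn -exprM mulnC exprM [X in _ <= X]natrM !natrX ler_wpM2r ?exprn_ge0 //.
by rewrite lerXn2r ?qualifE /= ?exprn_ge0 ?sumr_ge0.
Qed.

End Counting.

End BilinearSums.

(** * The additive energy of factorials *)

(** Take powers of a primitive [p]-th root of unity. *)
Lemma additive_char_exists p : prime p -> exists e : 'F_p -> algC,
  [/\ forall x y, e (x + y) = e x * e y, forall x, `|e x| = 1
    & exists u, e u != 1].
Proof.
move=> pr; have p1 := prime_gt1 pr; have p0 := prime_gt0 pr.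
have [z zP] := C_prim_root_exists p0.
exists (fun x : 'F_p => z ^+ (x : nat)); split.
- move=> x y; rewrite -exprD -(prim_expr_mod zP (x + y)) /=.
  by congr (z ^+ (_ %% _)); rewrite Fp_cast.
- move=> x; rewrite normrX.
  suff -> : `|z| = 1 by rewrite expr1n.
  by apply/eqP; rewrite -(pexpr_eq1 p0) // -normrX (prim_expr_order zP) normr1.
- exists 1; rewrite -(prim_order_dvd zP) /=.
  by rewrite modn_small ?Fp_cast // dvdn1 gtn_eqF.
Qed.

(** Polynomials of distinct degrees are independent: only the last one reaches the top degree, so
    its coefficient vanishes, and induction removes it. *)
Lemma sum_scale_size_succ_eq0 (F : fieldType) (P : nat -> {poly F}) (c : nat -> F) n :
  (forall i, size (P i) = i.+1) -> \sum_(i < n) c i *: P i = 0 ->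
  forall i, (i < n)%N -> c i = 0.
Proof.
move=> sP; elim: n => // n IHn; rewrite big_ord_recr /= => S0.
have cn : c n = 0.
  have := congr1 (fun R : {poly F} => R`_n) S0.
  rewrite coefD coefZ coef0 coef_sum big1 ?add0r => [/eqP|i _].
    rewrite mulf_eq0 => /orP[/eqP //|].
    have -> : (P n)`_n = lead_coef (P n) by rewrite lead_coefE sP.
    by rewrite lead_coef_eq0 -size_poly_eq0 sP.
  by rewrite coefZ nth_default ?mulr0 // sP ltn_ord.
move=> i; rewrite ltnS leq_eqVlt => /orP[/eqP -> //|]; apply: IHn.
by rewrite cn scale0r addr0 in S0.
Qed.

(** * Rising factorials and zeros of signed sums of factorials *)

Section RisingFactorial.
Variable F : fieldType.

Definition rising_fact n : {poly F} := \prod_(i < n) ('X + i.+1%:R%:P).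

Lemma size_rising_fact n : size (rising_fact n) = n.+1.
Proof.
rewrite /rising_fact; elim: n => [|n IHn]; first by rewrite big_ord0 size_poly1.
rewrite big_ord_recr /= size_mul ?IHn ?size_XaddC ?addn2 //.
  by rewrite -size_poly_eq0 IHn.
by rewrite -size_poly_eq0 size_XaddC.
Qed.

Lemma horner_rising_fact m n :
  m`!%:R * (rising_fact n).[m%:R] = (m + n)`!%:R :> F.
Proof.
rewrite /rising_fact; elim: n => [|n IHn]; first by rewrite big_ord0 hornerC mulr1 addn0.
rewrite big_ord_recr /= hornerM mulrA IHn hornerD hornerX hornerC -natrD.
by rewrite addnS factS mulnC natrM.
Qed.

End RisingFactorial.

Lemma natr_Fp_inj p m n : prime p -> (m < p)%N -> (n < p)%N ->
  m%:R = n%:R :> 'F_p -> m = n.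
Proof.
move=> pr mp np /(congr1 (fun x : 'F_p => x : nat)).
by rewrite /= !val_Fp_nat // !modn_small.
Qed.

Lemma factr_neq0 p m : prime p -> (m < p)%N -> m`!%:R != 0 :> 'F_p.
Proof.
move=> pr; elim: m => [|m IHm] mp; first by rewrite oner_eq0.
rewrite factS natrM mulf_neq0 ?IHm 1?ltnW //.
by apply: contraTneq isT => /(@natr_Fp_inj p m.+1 0 pr mp (prime_gt0 pr)).
Qed.

(** After division by [m!] the sum is the value at [m] of a combination [R] of rising factorials.
    Since [t0] alone takes the value [h t0], the coefficient there is [s t0], so [R] is nonzero,
    with fewer than [H] roots. The [m] below [p] are distinct residues. *)
Lemma card_fact_sum_eq0 p n H (T : finType) (s : T -> 'F_p) (h : T -> 'I_H) t0 :
  prime p -> (n <= p)%N -> s t0 != 0 -> (forall t, h t = h t0 -> t = t0) ->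
  (#|[set m : 'I_n | \sum_t s t * (m + h t)`!%:R == 0]%R| <= H)%N.
Proof.
move=> pr np s0 ht0.
pose R : {poly 'F_p} := \sum_t s t *: rising_fact 'F_p (h t).
have R0 : R != 0.
  apply: contra_neq s0 => R0.
  pose c i := \sum_(t | h t == i :> nat) s t.
  have <- : c (h t0) = s t0.
    rewrite /c (big_pred1 t0) // => t; apply/eqP/eqP => [/val_inj/ht0 //|-> //].
  apply: (@sum_scale_size_succ_eq0 _ (rising_fact 'F_p) c H (@size_rising_fact _)) => //.
  rewrite -[RHS]R0 /R (partition_big h predT) //=; apply: eq_bigr => i _.
  by rewrite scaler_suml; apply: eq_bigr => t /eqP <-.
have sR : (size R <= H)%N.
  apply: leq_trans (size_sum _ _ _) _; apply/bigmax_leqP => t _.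
  by apply: leq_trans (size_scale_leq _ _) _; rewrite size_rising_fact.
set M := [set m | _].
pose rs : seq 'F_p := [seq (nat_of_ord m)%:R | m <- enum M].
have -> : #|M| = size rs by rewrite size_map cardE.
apply: leq_trans (leq_trans _ sR); first exact: leqnn.
apply: ltnW; apply: max_poly_roots => //.
  apply/allP => _ /mapP[m mM ->]; move: mM; rewrite mem_enum inE => /eqP eq0.
  have m0 : (m : nat)`!%:R != 0 :> 'F_p by rewrite factr_neq0 // (leq_trans _ np).
  apply/rootP; apply: (mulfI m0); rewrite mulr0 -[RHS]eq0 /R horner_sum mulr_sumr.
  by apply: eq_bigr => t _; rewrite hornerZ mulrCA horner_rising_fact.
rewrite map_inj_uniq ?enum_uniq // => m1 m2 /natr_Fp_inj E; apply/val_inj/E => //.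
  by rewrite (leq_trans _ np).
by rewrite (leq_trans _ np).
Qed.

(** A union bound over the position of the zero, multiplied through by [n.+1] to avoid the exponent
    [#|T| - 1]. The map [zero_at] puts 0 at a position and returns the erased entry, so it reaches
    every pair counted on the left. *)
Lemma card_ffun_with_zero (T : finType) n :
  (n.+1 * #|[set h : {ffun T -> 'I_n.+1} | [exists t, h t == ord0]]|
    <= #|T| * n.+1 ^ #|T|)%N.
Proof.
pose zero_at (u : T * {ffun T -> 'I_n.+1}) :=
  ([ffun t => if t == u.1 then ord0 else u.2 t], u.2 u.1).
rewrite -[X in (X * _)%N]card_ord mulnC -(cardsT 'I_n.+1) -cardsX.
rewrite -[X in (_ <= _ * X ^ _)%N]card_ord -card_ffun -card_prod.
apply: leq_trans (leq_imset_card zero_at _).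
apply/subset_leq_card/fintype.subsetP => -[h v]; rewrite !inE andbT => /existsP[t /eqP ht].
apply/imsetP; exists (t, [ffun u => if u == t then v else h u]) => //.
rewrite /zero_at /= ffunE eqxx; congr (_, _); apply/ffunP => u; rewrite !ffunE.
by case: eqP => // ->.
Qed.

Definition repeated (T V : finType) (h : {ffun T -> V}) :=
  [forall t, exists u, (u != t) && (h u == h t)].

Lemma repeatedPn (T V : finType) (h : {ffun T -> V}) :
  ~~ repeated h -> exists t0, forall t, h t = h t0 -> t = t0.
Proof.
case/forallPn => t0 /existsPn ht0; exists t0 => t htt0.
by apply/eqP; have := ht0 t; rewrite htt0 eqxx andbT negbK.
Qed.

Lemma card_image_repeated (T V : finType) (h : {ffun T -> V}) :
  repeated h -> (2 * #|[set h t | t in T]| <= #|T|)%N.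
Proof.
move=> /forallP rep; rewrite -[X in (_ <= X)%N]sum1_card.
rewrite (partition_big_imset h) /= mulnC -sum_nat_const; apply: leq_sum => v.
case/imsetP => t _ ->; have /existsP[u /andP[ut hut]] := rep t.
by rewrite (bigD1 t) ?eqxx //= (bigD1 u) ?hut ?ut //=.
Qed.

(** Such an [h] has at most [l] values, so it factors through ['I_l] as an enumeration [g] of its
    values after an index map [phi]; a zero of [h] is a zero of [g]. *)
Lemma card_repeated_with_zero (T : finType) l n : #|T| = (2 * l)%N ->
  (#|[set h : {ffun T -> 'I_n.+1} | repeated h & [exists t, h t == ord0]]| <=
   l ^ #|T| * #|[set h : {ffun 'I_l -> 'I_n.+1} | [exists t, h t == ord0]]|)%N.
Proof.
move=> cT; set Z := [set h : {ffun 'I_l -> _} | _].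
pose comp (u : {ffun T -> 'I_l} * {ffun 'I_l -> 'I_n.+1}) := [ffun t => u.2 (u.1 t)].
rewrite -[X in (X ^ _)%N]card_ord -card_ffun -(cardsT {ffun T -> 'I_l}) -cardsX.
apply: leq_trans (leq_imset_card comp _).
apply/subset_leq_card/fintype.subsetP => h; rewrite !inE => /andP[rep /existsP[t0 /eqP ht0]].
pose V := [set h t | t in T].
have sV : (#|V| <= l)%N.
  by rewrite -(leq_pmul2l (ltn0Sn 1)) -cT card_image_repeated.
have ltV t : (index (h t) (enum V) < l)%N.
  apply: leq_trans sV; rewrite cardE index_mem mem_enum.
  by apply/imsetP; exists t.
pose phi := [ffun t => Ordinal (ltV t)].
(* The default [ord0] only fills the indices beyond the number of values, which [phi] never
   takes. *)
pose g := [ffun i : 'I_l => nth ord0 (enum V) i].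
have gphi t : g (phi t) = h t.
  by rewrite !ffunE /= nth_index // mem_enum; apply/imsetP; exists t.
apply/imsetP; exists (phi, g); last by apply/ffunP => t; rewrite ffunE gphi.
by rewrite !inE /=; apply/existsP; exists (phi t0); rewrite gphi ht0.
Qed.

(** Split the exponential sum along the [b] blocks, apply the power mean with exponent [2 * l.+1] at
    each frequency, and read the moments as energies. *)
Lemma energy_blocks (F : finFieldType) (e : F -> algC) (I : finType) (f : I -> F)
    (A : {set I}) b (blk : I -> 'I_b) l :
  (forall x y, e (x + y) = e x * e y) -> (forall x, `|e x| = 1) ->
  (exists u, e u != 1) ->
  (energy f l.+1 A <=
    b ^ (2 * l).+1 * \sum_c energy f l.+1 [set i in A | blk i == c])%N.
Proof.
move=> eD e_norm e_nt.
have q0 : 0 < #|F|%:R :> algC by rewrite ltr0n; apply/card_gt0P; exists 0.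
rewrite -(ler_nat algC) -(ler_pM2l q0) -(moment1 eD e_norm e_nt) natrM natrX.
rewrite natr_sum mulrCA mulr_sumr.
under [X in _ <= _ * X]eq_bigr do rewrite -(moment1 eD e_norm e_nt).
rewrite exchange_big mulr_sumr /=; apply: ler_sum => a _.
have -> : expsum e f A (fun=> 1) a =
    \sum_c expsum e f [set i in A | blk i == c] (fun=> 1) a.
  rewrite /expsum (partition_big blk predT) //=; apply: eq_bigr => c _.
  by apply: eq_bigl => i; rewrite inE.
pose S c := expsum e f [set i in A | blk i == c] (fun=> 1) a.
rewrite mulnS -[X in X <= _]/(`|\sum_c S c| ^+ (2 * l).+2).
apply: le_trans (lerXn2r _ _ _ (ler_norm_sum _ _ _)) _; rewrite ?qualifE /= ?sumr_ge0 //.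
have := @power_mean_card algC _ 'I_b (fun c => `|S c|) (2 * l).+1 (fun c _ => normr_ge0 _).
by rewrite card_ord.
Qed.

Definition ord_interval L N : {set 'I_(L + N).+1} := [set i : 'I__ | L < i]%N.

Lemma card_ord_interval L N : #|ord_interval L N| = N.
Proof.
rewrite -sum1_card (eq_bigl (fun i : 'I__ => L < i)%N) => [|i]; last by rewrite inE.
rewrite -(big_mkord (fun i => L < i)%N (fun=> 1%N)) sum1_count.
rewrite /index_iota subn0 -addSn iotaD count_cat.
rewrite (@eq_in_count _ _ pred0) ?count_pred0 ?add0n => [|i]; last first.
  by rewrite mem_iota /=; lia.
rewrite (@eq_in_count _ _ predT) ?count_predT ?size_iota // => i.
by rewrite mem_iota /=; lia.
Qed.

Lemma plusminus_neq0 (F : finFieldType) l (t : 'I_l + 'I_l) : plusminus F t != 0.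
Proof. by case: t => _ /=; rewrite ?oppr_eq0 oner_eq0. Qed.

Definition factr p n (i : 'I_n) : 'F_p := i`!%:R.

(** * Solutions within one block *)

Section FactorialEnergy.
Variables (p L N l n : nat).
Hypotheses (pr : prime p) (ltp : (L + N < p)%N).
Local Notation H := n.+1.
Local Notation T := ('I_l.+1 + 'I_l.+1)%type.
Local Notation S := (ord_interval L N).

Let solution (u : {ffun T -> 'I_H} * 'I_(L + N).+1) :=
  \sum_t plusminus 'F_p t * (u.2 + u.1 t)`!%:R == 0.

(** Offsets are measured from the smallest variable, whose own offset is 0. *)
Let offsets := [set h : {ffun T -> 'I_H} | [exists t, h t == ord0]].

Let G := [set u : {ffun T -> 'I_H} * 'I_(L + N).+1 |
   [&& u.1 \in offsets, u.2 \in S & solution u]].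

Let blk (i : 'I_(L + N).+1) : 'I_(N %/ H).+1 := inord ((i - L.+1) %/ H).

(** Each solution with its variables in one block is recovered by [z_of] from its minimum and its
    offsets, which are below [H]. Its block is read off at the arbitrary index [t0], so different
    blocks give different solutions. *)
Let sum_energy_le :
  (\sum_c energy (@factr p _) l.+1 [set i in S | blk i == c] <= #|G|)%N.
Proof.
pose t0 : T := inl ord0.
pose z_of (u : {ffun T -> 'I_H} * 'I_(L + N).+1) : {ffun T -> 'I_(L + N).+1} :=
  [ffun t => inord (u.2 + u.1 t)].
apply: leq_trans (leq_imset_card z_of _).
rewrite -[X in (_ <= X)%N]sum1_card.
rewrite (partition_big (fun z : {ffun T -> 'I_(L + N).+1} => blk (z t0)) predT) //=.
apply: leq_sum => c _; rewrite sum1_card /energy; apply/subset_leq_card/fintype.subsetP => z.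
rewrite inE => /andP[/ffun_onP zS /eqP zeq].
have zL t : (L < z t)%N by have := zS t; rewrite !inE => /andP[].
have zc t : blk (z t) = c by have := zS t; rewrite !inE => /andP[_ /eqP].
rewrite -topredE /= zc eqxx andbT.
have zblk t : ((z t - L.+1) %/ H = c)%N.
  rewrite -(zc t) inordK // ltnS leq_div2r //; have := ltn_ord (z t); lia.
case: (arg_minnP (fun t => z t : nat) (isT : predT t0)) => t1 _ zmin.
have zH t : (z t - z t1 < H)%N.
  have := divn_eq (z t - L.+1) H; have := divn_eq (z t1 - L.+1) H.
  rewrite !zblk; have := ltn_pmod (z t - L.+1) (ltn0Sn n).
  have := zmin t isT; have := zL t; have := zL t1; lia.
have zK t : (z t1 + (z t - z t1))%N = z t by rewrite subnKC ?zmin.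
apply/imsetP; exists ([ffun t => inord (z t - z t1)], z t1); last first.
  by apply/ffunP => t; rewrite !ffunE /= inordK // zK inord_val.
rewrite !inE /= zL; apply/and3P; split => //.
  by apply/existsP; exists t1; rewrite ffunE subnn; apply/eqP/val_inj; rewrite /= inordK.
apply/eqP; rewrite -[RHS]zeq; apply: eq_bigr => t _.
by rewrite /= ffunE inordK // zK.
Qed.

(** For repeated offsets every base point is allowed; otherwise some offset occurs once and
    [card_fact_sum_eq0] leaves at most [H] base points. *)
Let card_G_le : (#|G| <= #|[set h in offsets | repeated h]| * N + #|offsets| * H)%N.
Proof.
rewrite -sum1_card.
rewrite (eq_bigl (fun u : {ffun T -> 'I_H} * 'I_(L + N).+1 =>
   (u.1 \in offsets) && ((u.2 \in S) && solution u))) => [|u]; last by rewrite inE.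
rewrite -(pair_big_dep (fun h => h \in offsets)
  (fun h m => (m \in S) && solution (h, m)) (fun _ _ => 1%N)) /=.
rewrite (bigID (@repeated T 'I_H)) /= leq_add //.
  rewrite -sum_nat_const; under [X in (_ <= X)%N]eq_bigl do rewrite inE.
  apply: leq_sum => h _; rewrite sum1_card -[X in (_ <= X)%N](card_ord_interval L N).
  by apply/subset_leq_card/fintype.subsetP => m /andP[].
apply: (@leq_trans (\sum_(h in offsets | ~~ repeated h) H)%N).
  apply: leq_sum => h /andP[_ /repeatedPn[t0 ht0]]; rewrite sum1_card.
  have := @card_fact_sum_eq0 p _ H T (@plusminus 'F_p l.+1) h t0 pr ltp _ ht0.
  move=> le; apply: leq_trans (le _).
    by apply/subset_leq_card/fintype.subsetP => m; rewrite inE => /andP[].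
  by rewrite plusminus_neq0.
rewrite sum_nat_const leq_mul2r; apply/orP; right.
by apply/subset_leq_card/fintype.subsetP => h /andP[].
Qed.

Lemma energy_fact_le :
  (H * energy (@factr p _) l.+1 S <= (N %/ H).+1 ^ (2 * l).+1 *
   (l.+1 ^ (2 * l.+1) * (l.+1 * H ^ l.+1) * N + H * (2 * l.+1 * H ^ (2 * l.+1))))%N.
Proof.
have [e [eD e_norm e_nt]] := additive_char_exists pr.
have leE := energy_blocks (@factr p _) S blk l eD e_norm e_nt.
apply: leq_trans (leq_mul (leqnn H) leE) _.
rewrite mulnCA leq_mul2l; apply/orP; right.
apply: leq_trans (leq_mul (leqnn H) (leq_trans sum_energy_le card_G_le)) _.
have cT : #|{: T}| = (2 * l.+1)%N by rewrite card_sum card_ord mul2n addnn.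
rewrite mulnDr; apply: leq_add; last first.
  rewrite mulnA mulnC leq_mul2l; apply/orP; right.
  by rewrite -cT card_ffun_with_zero.
rewrite mulnA leq_mul2r; apply/orP; right.
have le1 : (#|[set h in offsets | repeated h]| <= l.+1 ^ #|{: T}| *
    #|[set h : {ffun 'I_l.+1 -> 'I_H} | [exists t, h t == ord0]]|)%N.
  apply: leq_trans (card_repeated_with_zero n cT).
  by apply/subset_leq_card/fintype.subsetP => h; rewrite !inE andbC.
apply: leq_trans (leq_mul (leqnn H) le1) _.
rewrite mulnCA cT leq_mul2l; apply/orP; right.
by apply: leq_trans (card_ffun_with_zero _ _) _; rewrite card_ord.
Qed.

End FactorialEnergy.

Lemma exists_floor_root N m : (0 < N)%N ->
  exists n, (n.+1 ^ m.+1 <= N < n.+2 ^ m.+1)%N.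
Proof.
move=> N0.
have ex : exists n, (n.+1 ^ m.+1 <= N)%N by exists 0%N; rewrite exp1n.
have ub n : (n.+1 ^ m.+1 <= N)%N -> (n <= N)%N.
  by move=> le; apply: ltnW; apply: leq_trans le; rewrite expnS leq_pmulr ?expn_gt0.
case: (ex_maxnP ex ub) => n le max_n; exists n; rewrite le /= ltnNge.
by apply/negP => /max_n; rewrite ltnn.
Qed.

Lemma energy_fact_block_le l : exists C, forall p L N, prime p -> (L + N < p)%N ->
  (0 < N)%N -> exists2 H, (H ^ l.+2 <= N)%N &
  (energy (@factr p _) l.+1 (ord_interval L N) <= C * N ^ (2 * l).+1 * H)%N.
Proof.
(* The two summands come from repeated and from other offsets. With [H] near the [m.+1]-th root of
   [N], both contributions have order [H ^ (2 * m).+1]; the power of 2 comes from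
   [N <= (2 * H) ^ m.+1]. *)
set m := l.+1; pose C0 := (m ^ (2 * m) * m * 2 ^ m.+1 + 2 * m)%N.
exists (2 ^ (2 * l).+1 * C0)%N => p L N pr ltp N0.
have [n /andP[leN ltN]] := exists_floor_root m N0.
exists n.+1 => //; set H := n.+1 in leN *.
have N2H : (N <= 2 ^ m.+1 * H ^ m.+1)%N.
  by rewrite -expnMn; apply: leq_trans (ltnW ltN) _; rewrite leq_exp2r //; lia.
have HN : (H <= N)%N by apply: leq_trans leN; rewrite expnS leq_pmulr ?expn_gt0.
have bH : ((N %/ H).+1 * H <= 2 * N)%N by rewrite mulSn; have := leq_divM N H; lia.
have := energy_fact_le l n pr ltp; rewrite -/H -/m; set E := energy _ _ _ => leE.
(* Multiplying by [H ^ (2 * m)] supplies one [H] for [energy_fact_le] and one for each factor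
   [(N %/ H).+1]. *)
have H0 : (0 < H ^ (2 * m))%N by rewrite expn_gt0.
rewrite -(leq_pmul2l H0).
have -> : (H ^ (2 * m) * E = H ^ (2 * l).+1 * (H * E))%N.
  by rewrite mulnA -expnSr; congr (H ^ _ * _)%N; rewrite /m; lia.
apply: leq_trans (leq_mul (leqnn _) leE) _.
rewrite mulnA -expnMn [(H * (N %/ H).+1)%N]mulnC.
have le2 : (m ^ (2 * m) * (m * H ^ m) * N + H * (2 * m * H ^ (2 * m)) <=
   C0 * H ^ (2 * m).+1)%N.
  rewrite /C0 mulnDl; apply: leq_add; last by rewrite expnS; lia.
  apply: leq_trans (leq_mul (leqnn _) N2H) _.
  have -> : ((2 * m).+1 = m + m.+1)%N by lia.
  by rewrite (expnD H); lia.
have le3 : (((N %/ H).+1 * H) ^ (2 * l).+1 <= 2 ^ (2 * l).+1 * N ^ (2 * l).+1)%N.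
  by rewrite -expnMn leq_exp2r.
apply: leq_trans (leq_mul le3 le2) _.
by rewrite (expnS H (2 * m)); lia.
Qed.

Lemma energy_fact_powR (R : realType) l : exists2 c : R, 0 <= c &
  forall p L N, prime p -> (L + N < p)%N -> (0 < N)%N ->
  (energy (@factr p _) l (ord_interval L N))%:R <=
    c * N%:R `^ (2 * l%:R - 1 + 1 / (l%:R + 1)).
Proof.
case: l => [|l].
  (* For [l = 0] there is at most the empty tuple, and the exponent is [-1 + 1 = 0]. *)
  exists 1 => // p L N _ _ _.
  rewrite mulr0 sub0r add0r divr1 addNr powRr0 mulr1 lern1.
  apply: leq_trans (max_card _) _.
  by rewrite card_ffun card_sum !card_ord.
have [C leC] := energy_fact_block_le l.
exists C%:R => // p L N pr ltp N0.
have [H HN leE] := leC p L N pr ltp N0.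
have N0' : 0 < N%:R :> R by rewrite ltr0n.
apply: le_trans (_ : (C * N ^ (2 * l).+1 * H)%:R <= _); first by rewrite ler_nat.
rewrite !natrM -mulrA ler_wpM2l // natrX.
rewrite powRD; last by rewrite gt_eqF // implybT.
have -> : N%:R `^ (2 * l.+1%:R - 1) = N%:R ^+ (2 * l).+1 :> R.
  rewrite -powR_mulrn //; congr (_ `^ _).
  by rewrite -!natr1 natrM; ring.
apply: ler_wpM2l; first by rewrite exprn_ge0.
have l2 : l.+1%:R + 1 != 0 :> R by rewrite natr1 pnatr_eq0.
have -> : H%:R = (H%:R ^+ l.+2) `^ (1 / (l.+1%:R + 1)) :> R.
  by rewrite -powR_mulrn // -powRrM -[l.+2%:R]natr1 mul1r divff // powRr1.
apply: ge0_ler_powR; rewrite ?nnegrE ?exprn_ge0 // -?natrX ?ler_nat //.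
Qed.

(** * The theorem *)

Lemma Q_solutions p r1 r2 K M L N lambda : prime p ->
  Q p (r1 + r2) K M L N lambda =
  #|solutions (@factr p _) (@factr p _) (ord_interval K M) (ord_interval L N)
      r1 r2 lambda%:~R|.
Proof.
move=> pr; apply: eq_card => -[[m n] s]; rewrite !inE /=.
congr [&& _, _, _ & _].
  apply/forallP/ffun_onP => sL i; by have := sL i; rewrite inE.
rewrite eqz_mod_dvd (dvdz_pcharf (pchar_Fp pr)) rmorphB /= subr_eq0.
by rewrite -pmulrn natrD natrM natr_sum.
Qed.

(** Dividing the deviation by [p] cancels the factors [p] of the two moments exactly; only the [p]
    of the bilinear bound survives. *)
Lemma Q_deviation_le (R : realType) p r1 r2 k l K M L N lambda
    (n := (2 * (k.+1 * l.+1))%N) :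
  prime p ->
  `|(Q p (r1 + r2) K M L N lambda)%:R - M%:R * N%:R ^+ (r1 + r2).+1 / p%:R| ^+ (n * 2)
  <= ((energy (@factr p _) r1 (ord_interval L N))%:R *
      (energy (@factr p _) r2 (ord_interval L N))%:R) ^+ n *
     (M%:R ^+ (2 * (k.+1 * l)) * N%:R ^+ (2 * (k * l.+1)) *
      ((energy (@factr p _) k.+1 (ord_interval K M))%:R *
       (p%:R * (energy (@factr p _) l.+1 (ord_interval L N))%:R))) ^+ 2 :> R.
Proof.
move=> pr; have p0 : 0 < p%:R :> R by rewrite ltr0n prime_gt0.
have [e [eD e_norm e_nt]] := additive_char_exists pr.
have := card_solutions_deviation eD e_norm e_nt (@factr p (K + M).+1)
  (@factr p (L + N).+1) (ord_interval K M) (ord_interval L N) r1 r2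
  lambda%:~R k l.
cbv zeta; rewrite -/n -Q_solutions // card_Fp // !card_ord_interval -(ler_int R).
rewrite rmorphXn /= intr_norm rmorphB /= -!pmulrn /bilinear_bound.
rewrite card_Fp // !card_ord_interval.
set x := `|_|; set y := `|_| => le.
have xy : x = p%:R * y.
  rewrite /x /y -[X in X * `|_|](gtr0_norm p0) -normrM mulrBr mulrCA divff ?gt_eqF //.
  by rewrite mulr1 !natrM natrX.
rewrite -(ler_pM2l (exprn_gt0 (n * 2) p0)) -exprMn -xy.
apply: le_trans le _; rewrite le_eqVlt; apply/orP; left; apply/eqP.
rewrite !(natrM, natrX) -[(M%:R ^+ _) ^+ l ^+ 2]exprM -exprM -[(N%:R ^+ _) ^+ _]exprM.
rewrite [(l * 2)%N]mulnC mulnCA [(k * (2 * _))%N]mulnCA (exprM _ n) !(exprMn n).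
by ring.
Qed.

(** Since [C <= (1 + C) ^+ n.+1], roots can be extracted without taking a root of the constant. *)
Lemma ler_expn_mul (R : realDomainType) (x y C : R) n :
  0 <= x -> 0 <= y -> 0 <= C ->
  x ^+ n.+1 <= C * y ^+ n.+1 -> x <= (1 + C) * y.
Proof.
move=> x0 y0 C0 le.
rewrite -(ler_pXn2r (ltn0Sn n)) ?qualifE /= ?mulr_ge0 ?addr_ge0 //.
apply: le_trans le _; rewrite exprMn ler_wpM2r ?exprn_ge0 //.
apply: (@le_trans _ _ (1 + C)); first by rewrite lerDr.
by rewrite exprS ler_peMr ?addr_ge0 // exprn_ege1 // lerDl.
Qed.

Lemma Q_deviation_powR (R : realType) (k l r1 r2 : nat) :
  exists2 c : R, 0 < c & forall (p K M L N : nat) (lambda : int),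
      prime p -> (K < K + M < p)%N -> (L < L + N < p)%N ->
      `|(Q p (r1 + r2) K M L N lambda)%:R - M%:R * N%:R ^+ (r1 + r2).+1 / p%:R| <=
        c * (M%:R `^ (1 - 1 / (2 * l.+1%:R * (k.+1%:R + 1)))
             * N%:R `^ ((r1 + r2)%:R + 1 / (2 * (r1%:R + 1)) + 1 / (2 * (r2%:R + 1))
                        - 1 / (2 * k.+1%:R * (l.+1%:R + 1)))
             * p%:R `^ (1 / (2 * k.+1%:R * l.+1%:R))).
Proof.
have [c1 c1_ge0 E1] := energy_fact_powR R r1.
have [c2 c2_ge0 E2] := energy_fact_powR R r2.
have [ck ck_ge0 Ek] := energy_fact_powR R k.+1.
have [cl cl_ge0 El] := energy_fact_powR R l.+1.
pose n := (2 * (k.+1 * l.+1))%N.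
pose C := (c1 * c2) ^+ n * (ck * cl) ^+ 2.
have C_ge0 : 0 <= C by rewrite mulr_ge0 ?exprn_ge0 ?mulr_ge0.
exists (1 + C) => [|p K M L N lambda pr /andP[KM Mp] /andP[LN Np]].
  by rewrite ltr_pwDl.
have M0 : (0 < M)%N by lia.
have N0 : (0 < N)%N by lia.
have [Mx0 Nx0 px0] : [/\ 0 < M%:R :> R, 0 < N%:R :> R & 0 < p%:R :> R].
  by rewrite !ltr0n M0 N0 prime_gt0.
have nE : (n * 2 = (n * 2).-1.+1)%N by [].
apply: (@ler_expn_mul _ _ _ _ (n * 2).-1) => //.
rewrite -nE; apply: le_trans (Q_deviation_le R r1 r2 k l K M L N lambda pr) _.
rewrite -/n.
set e1 := 2 * r1%:R - 1 + _ in E1; set e2 := 2 * r2%:R - 1 + _ in E2.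
set ek := 2 * k.+1%:R - 1 + _ in Ek; set el := 2 * l.+1%:R - 1 + _ in El.
apply: (@le_trans _ _ (((c1 * N%:R `^ e1) * (c2 * N%:R `^ e2)) ^+ n *
   (M%:R ^+ (2 * (k.+1 * l)) * N%:R ^+ (2 * (k * l.+1)) *
    ((ck * M%:R `^ ek) * (p%:R * (cl * N%:R `^ el)))) ^+ 2)).
  apply: ler_pM; rewrite ?exprn_ge0 ?mulr_ge0 ?exprn_ge0 //.
    by rewrite lerXn2r ?qualifE /= ?mulr_ge0 ?powR_ge0 // ler_pM ?E1 ?E2.
  rewrite lerXn2r ?qualifE /= ?mulr_ge0 ?powR_ge0 ?exprn_ge0 //.
  rewrite ler_wpM2l ?mulr_ge0 ?exprn_ge0 //.
  by rewrite ler_pM ?mulr_ge0 ?Ek // ler_wpM2l ?El.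
(* Both sides are now [C] times powers of [M], [N] and [p], so it remains to match three
   exponents. *)
rewrite le_eqVlt; apply/orP; left; apply/eqP.
have pexp (x a : R) i : 0 < x -> x `^ a ^+ i = x `^ (a * i%:R).
  by move=> x0; rewrite -powR_mulrn ?powR_ge0 // powRrM.
have pexp1 (x : R) i : 0 < x -> x ^+ i = x `^ (i%:R).
  by move=> x0; rewrite powR_mulrn ?ltW.
have padd (x a b : R) : 0 < x -> x `^ a * x `^ b = x `^ (a + b).
  by move=> x0; rewrite powRD //; apply/implyP => _; rewrite gt_eqF.
have [k0 l0] : 0 <= k%:R :> R /\ 0 <= l%:R :> R by [].
have [r10 r20] : 0 <= r1%:R :> R /\ 0 <= r2%:R :> R by [].
have nR : n%:R = 2 * ((k%:R + 1) * (l%:R + 1)) :> R by rewrite /n !natrM !natr1.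
have ME : M%:R ^+ (2 * (k.+1 * l)) ^+ 2 * M%:R `^ ek ^+ 2 =
    M%:R `^ ((2 * (k.+1 * l))%:R * 2 + ek * 2) :> R.
  by rewrite (pexp1 _ (_ * _)%N) // !pexp // padd.
have NE : N%:R `^ e1 ^+ n * N%:R `^ e2 ^+ n * N%:R ^+ (2 * (k * l.+1)) ^+ 2 *
    N%:R `^ el ^+ 2 =
    N%:R `^ (e1 * n%:R + e2 * n%:R + (2 * (k * l.+1))%:R * 2 + el * 2) :> R.
  by rewrite (pexp1 _ (2 * (k * _))%N) // !pexp // !padd.
transitivity (C * (M%:R `^ ((2 * (k.+1 * l))%:R * 2 + ek * 2) *
   N%:R `^ (e1 * n%:R + e2 * n%:R + (2 * (k * l.+1))%:R * 2 + el * 2) * p%:R `^ 2)).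
  by rewrite -ME -NE -(pexp1 _ 2%N) // /C !exprMn; ring.
rewrite !exprMn !pexp //; congr (_ * (_ `^ _ * _ `^ _ * _ `^ _)).
- rewrite /ek [(n * 2)%:R]natrM nR !natrM -!natr1; field; lra.
- rewrite /e1 /e2 /el [(n * 2)%:R]natrM nR natrD -!natr1; field; lra.
- rewrite [(n * 2)%:R]natrM nR -!natr1; field; lra.
Qed.

Theorem theorem6 (R : realType) (k l r : nat) (hk : (1 <= k)%N) (hl : (1 <= l)%N) :
  let r1 := (r %/ 2)%N in
  let r2 := (r.+1 %/ 2)%N in
  exists2 c : R, 0 < c &
    forall (p K M L N : nat) (lambda : int),
      prime p -> odd p ->
      (K < K + M < p)%N -> (L < L + N < p)%N ->
      `|(Q p r K M L N lambda)%:R - M%:R * N%:R ^+ r.+1 / p%:R| <=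
        c * (M%:R `^ (1 - 1 / (2 * l%:R * (k%:R + 1)))
             * N%:R `^ (r%:R + 1 / (2 * (r1%:R + 1)) + 1 / (2 * (r2%:R + 1))
                        - 1 / (2 * k%:R * (l%:R + 1)))
             * p%:R `^ (1 / (2 * k%:R * l%:R))).
Proof.
case: k hk => // k _; case: l hl => // l _ r1 r2.
have [c c0 le_c] := Q_deviation_powR R k l r1 r2.
have r12 : (r1 + r2 = r)%N by rewrite /r1 /r2; lia.
exists c => // p K M L N lambda pr _ KM LN.
by have := le_c p K M L N lambda pr KM LN; rewrite r12.
Qed.
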